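(* For real $\alpha,\nu$ and $x>0$ let $$b_\alpha(\nu,x)=\frac{x}{\lambda+\sqrt{\lambda^2+x^2}},\qquad \lambda=\nu+\tfrac12(\alpha-1).$$ Then for all $x>0$ $$\frac{I_{\nu}(x)}{I_{\nu-1}(x)}<b_0(\nu,x)=\frac{x}{\nu-1/2+\sqrt{(\nu-1/2)^2+x^2}},\qquad \nu\ge 1/2,$$ $$\frac{I_{\nu}(x)}{I_{\nu-1}(x)}>b_1(\nu,x)=\frac{x}{\nu+\sqrt{\nu^2+x^2}},\qquad \nu\ge 0.$$ These bounds are the best possible of the form $b_\alpha(\nu,x)$, $\alpha\in\mathbb{R}$, in their range of validity. That is: if $\alpha\in\mathbb{R}$ is such that $b_\alpha(\nu,x)$ is an upper bound for $I_\nu(x)/I_{\nu-1}(x)$ for all $\nu\ge 1/2$ and $x>0$, then $b_0(\nu,x)\le b_\alpha(\nu,x)$ for all $\nu\ge1/2$, $x>0$; and if $\alpha\in\mathbb{R}$ is such that $b_\alpha(\nu,x)$ is a lower bound for $I_\nu(x)/I_{\nu-1}(x)$ for all $\nu\ge 0$ and $x>0$, then $b_\alpha(\nu,x)\le b_1(\nu,x)$ for all $\nu\ge 0$, $x>0$.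
   Context: $I_\nu$ denotes the modified Bessel function of the first kind of real order $\nu$; the parameter $\alpha$ is a constant independent of $\nu$ and $x$. *)

(* Defs.v *)
From Stdlib Require Import Reals Factorial.
From Coquelicot Require Import Coquelicot.
Open Scope R_scope.

(* Reciprocal Gamma function 1 / Gamma(z), for every real z, by Gauss's formula
     1 / Gamma(z) = lim_n  z (z + 1) ... (z + n) / (n! n^z).
   It vanishes at z = 0, -1, -2, ..., where Gamma has its poles, so the series
   below makes sense for negative integer orders too. *)
Definition rGamma (z : R) : R :=
  real (Lim_seq (fun n : nat =>
    prod_f_R0 (fun i : nat => z + INR i) n
      / (INR (fact n) * Rpower (INR n) z))).

(* Modified Bessel function of the first kind of real order nu, for x > 0:
     I_nu(x) = (x/2)^nu * sum_k (x^2/4)^k / (k! Gamma(nu + k + 1)). *)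
Definition BesselI (nu x : R) : R :=
  Rpower (x / 2) nu *
  PSeries (fun k : nat => rGamma (nu + INR k + 1) / INR (fact k)) (x ^ 2 / 4).

(* The denominator is positive for x > 0, whatever the sign of lambda. *)
Definition b_bound (alpha nu x : R) : R :=
  let lambda := nu + / 2 * (alpha - 1) in
  x / (lambda + sqrt (lambda ^ 2 + x ^ 2)).

(* Main.v *)
(** Put t = x^2/4, p = sum_k t^k/(k! Gamma(nu+k)) and q = p', so that
    I_nu/I_(nu-1) = (x/2) q/p. The upper bound says that
    E = p^2 - t q^2 - (nu - 1/2) p q is positive. The differential equation
    p = nu q + t q' gives (t^m E)' = m t^(m-1) p q/2 with m = nu - 1/2 >= 0, while
    E(0) = p(0) q(0)/2 > 0, whence E > 0. The recurrence
    I_nu/I_(nu-1) = x/(2 nu + x I_(nu+1)/I_nu) turns the upper bound at nu + 1 into a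
    lower bound stronger than b_1. For alpha > 0 that lower bound at nu = 1/2
    contradicts b_alpha being an upper bound; for alpha < 1 the estimate
    I_nu/I_(nu-1) < x/(2 nu) at nu = x = (1 - alpha)/2 contradicts b_alpha being a lower
    bound. *)

Require Import Defs.
From Stdlib Require Import Reals Factorial Lra Lia.
From Coquelicot Require Import Coquelicot.
Open Scope R_scope.

(** * Gauss's product: convergence, positivity and shift of the reciprocal Gamma function *)

Definition gauss (z : R) (n : nat) : R :=
  prod_f_R0 (fun i : nat => z + INR i) n / (INR (fact n) * Rpower (INR n) z).

(** Concavity of [ln]: its tangent at [m = z y + (1 - z)] lies above it at [y] and at 1; these two
    estimates are averaged with weights [z] and [1 - z]. *)
Lemma Rpower_bernoulli (y z : R) :
  0 < y -> 0 <= z <= 1 -> Rpower y z <= 1 + z * (y - 1).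
Proof.
intros Hy Hz.
set (m := 1 + z * (y - 1)).
assert (Hm : 0 < m).
{ unfold m. destruct (Rle_lt_dec 1 y); [nra|]. nra. }
assert (Hln : forall w, 0 < w -> ln w <= ln m + w / m - 1).
{ intros w Hw.
  assert (Hq : 0 < w / m) by (apply Rdiv_lt_0_compat; lra).
  pose proof (exp_ineq1_le (ln (w / m))) as H.
  rewrite exp_ln in H by exact Hq.
  replace w with (m * (w / m)) at 1 by (field; lra).
  rewrite ln_mult by lra. lra. }
pose proof (Hln y Hy) as H1.
pose proof (Hln 1 Rlt_0_1) as H2. rewrite ln_1 in H2.
assert (H3 : z * ln y <= ln m).
{ apply Rle_trans with (z * (ln m + y / m - 1) + (1 - z) * (ln m + 1 / m - 1)).
  - nra.
  - right. transitivity (ln m + (1 + z * (y - 1)) / m - 1).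
    + field; lra.
    + fold m. field; lra. }
unfold Rpower. rewrite <- (exp_ln m Hm).
destruct H3 as [H3|H3]; [left; now apply exp_increasing | right; now rewrite H3].
Qed.

Lemma Rpower_div (x y z : R) :
  0 < x -> 0 < y -> Rpower x z / Rpower y z = Rpower (x / y) z.
Proof.
intros Hx Hy. unfold Rpower, Rdiv.
rewrite ln_mult, ln_Rinv by (auto using Rinv_0_lt_compat).
rewrite <- exp_Ropp, <- exp_plus. f_equal. ring.
Qed.

Lemma rising_pos (z : R) (n : nat) :
  0 < z -> 0 < prod_f_R0 (fun i : nat => z + INR i) n.
Proof.
intros Hz. induction n as [|n IH].
- simpl; lra.
- apply Rmult_lt_0_compat; [exact IH|]. pose proof (pos_INR (S n)). lra.
Qed.

Lemma gauss_pos (z : R) (n : nat) : 0 < z -> 0 < gauss z n.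
Proof.
intros Hz. apply Rdiv_lt_0_compat.
- now apply rising_pos.
- apply Rmult_lt_0_compat; [apply INR_fact_lt_0 | apply exp_pos].
Qed.

(** Indices start at 1 because [Rpower (INR 0) z] is a mere default value; the limit does not see
    it. *)
Lemma gauss_succ (z : R) (n : nat) :
  gauss z (S (S n)) =
  gauss z (S n) * ((1 + z / INR (S (S n))) * Rpower (INR (S n) / INR (S (S n))) z).
Proof.
unfold gauss.
rewrite <- Rpower_div by (apply lt_0_INR; lia).
change (prod_f_R0 (fun i : nat => z + INR i) (S (S n)))
  with (prod_f_R0 (fun i : nat => z + INR i) (S n) * (z + INR (S (S n)))).
rewrite (fact_simpl (S n)), mult_INR.
assert (0 < INR (S (S n))) by (apply lt_0_INR; lia).
pose proof (INR_fact_lt_0 (S n)).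
pose proof (exp_pos (z * ln (INR (S n)))).
pose proof (exp_pos (z * ln (INR (S (S n))))).
unfold Rpower. field. repeat split; lra.
Qed.

(** By Bernoulli the factor in [gauss_succ] is at most [(1 + u) (1 - u) <= 1] with
    [u = z / (n + 2)]. *)
Lemma gauss_decr (z : R) (n : nat) :
  0 < z <= 1 -> gauss z (S (S n)) <= gauss z (S n).
Proof.
intros Hz. rewrite gauss_succ.
pose proof (gauss_pos z (S n) (proj1 Hz)) as Hg.
assert (HN : 0 < INR (S n)) by (apply lt_0_INR; lia).
rewrite (S_INR (S n)). set (N := INR (S n)) in *.
assert (HB : Rpower (N / (N + 1)) z <= 1 - z / (N + 1)).
{ replace (1 - z / (N + 1)) with (1 + z * (N / (N + 1) - 1)) by (field; lra).
  apply Rpower_bernoulli; [apply Rdiv_lt_0_compat; lra | lra]. }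
assert (0 < z / (N + 1)) by (apply Rdiv_lt_0_compat; lra).
assert (0 < Rpower (N / (N + 1)) z) by apply exp_pos.
rewrite <- (Rmult_1_r (gauss z (S n))) at 2.
apply Rmult_le_compat_l; [lra|]. nra.
Qed.

(* Normalising by [(n+1)^z] instead of [n^z] turns the decreasing sequence into an
   increasing one, which keeps the limit away from 0. *)
Lemma gauss_incr (z : R) (n : nat) : 0 < z <= 1 ->
  gauss z (S n) * Rpower (INR (S n) / INR (S (S n))) z <=
  gauss z (S (S n)) * Rpower (INR (S (S n)) / INR (S (S (S n)))) z.
Proof.
intros Hz. rewrite (gauss_succ z n).
pose proof (gauss_pos z (S n) (proj1 Hz)) as Hg.
assert (HN : 0 < INR (S n)) by (apply lt_0_INR; lia).
rewrite (S_INR (S (S n))), (S_INR (S n)). set (N := INR (S n)) in *.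
assert (HB : Rpower ((N + 1 + 1) / (N + 1)) z <= 1 + z / (N + 1)).
{ replace (1 + z / (N + 1)) with (1 + z * ((N + 1 + 1) / (N + 1) - 1)) by (field; lra).
  apply Rpower_bernoulli; [apply Rdiv_lt_0_compat; lra | lra]. }
assert (HP : Rpower ((N + 1 + 1) / (N + 1)) z * Rpower ((N + 1) / (N + 1 + 1)) z = 1).
{ rewrite Rpower_mult_distr by (apply Rdiv_lt_0_compat; lra).
  replace ((N + 1 + 1) / (N + 1) * ((N + 1) / (N + 1 + 1))) with 1 by (field; lra).
  unfold Rpower. rewrite ln_1, Rmult_0_r. apply exp_0. }
set (u := Rpower ((N + 1) / (N + 1 + 1)) z) in *.
assert (0 < u) by apply exp_pos.
set (w := Rpower (N / (N + 1)) z).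
assert (0 < w) by apply exp_pos.
assert (1 <= (1 + z / (N + 1)) * u) 
  by (apply Rmult_le_compat_r with (r := u) in HB; lra).
assert (0 < gauss z (S n) * w) by (apply Rmult_lt_0_compat; lra).
nra.
Qed.

Lemma gauss_lim_unit (z : R) : 0 < z <= 1 ->
  exists l, 0 < l /\ is_lim_seq (gauss z) l.
Proof.
intros Hz.
(* First term of the increasing sequence of [gauss_incr], which stays below [gauss]; so [c] bounds
   the decreasing sequence from below. *)
set (c := gauss z 1 * Rpower (INR 1 / INR 2) z).
assert (Hc : 0 < c) by (apply Rmult_lt_0_compat; [now apply gauss_pos | apply exp_pos]).
assert (Hlow : forall n, c <= gauss z (S n)).
{ intros n. apply Rle_trans with (gauss z (S n) * Rpower (INR (S n) / INR (S (S n))) z).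
  - induction n as [|n IH]; [apply Rle_refl|].
    eapply Rle_trans; [exact IH | now apply gauss_incr].
  - pose proof (gauss_pos z (S n) (proj1 Hz)).
    assert (Rpower (INR (S n) / INR (S (S n))) z <= 1).
    { assert (0 < INR (S n)) by (apply lt_0_INR; lia).
      rewrite (S_INR (S n)). set (N := INR (S n)) in *.
      assert (N / (N + 1) < 1) by (apply Rlt_div_l; lra).
      eapply Rle_trans; [apply Rpower_bernoulli; [apply Rdiv_lt_0_compat; lra | lra]|].
      nra. }
    nra. }
destruct (ex_finite_lim_seq_decr (fun n => gauss z (S n)) c) as [l Hl].
- intros n. now apply gauss_decr.
- exact Hlow.
- exists l. split.
  + apply Rlt_le_trans with c; [exact Hc|].
    assert (H : Rbar_le c l) by
      (apply (is_lim_seq_le (fun _ => c) (fun n => gauss z (S n)));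
       [exact Hlow | apply is_lim_seq_const | exact Hl]).
    exact H.
  + apply is_lim_seq_incr_1. exact Hl.
Qed.

Lemma rising_shift (z : R) (n : nat) :
  z * prod_f_R0 (fun i : nat => z + 1 + INR i) n =
  prod_f_R0 (fun i : nat => z + INR i) n * (z + 1 + INR n).
Proof.
induction n as [|n IH]; [simpl; ring|].
change (prod_f_R0 (fun i : nat => z + 1 + INR i) (S n))
  with (prod_f_R0 (fun i : nat => z + 1 + INR i) n * (z + 1 + INR (S n))).
change (prod_f_R0 (fun i : nat => z + INR i) (S n))
  with (prod_f_R0 (fun i : nat => z + INR i) n * (z + INR (S n))).
rewrite <- Rmult_assoc, IH, S_INR. ring.
Qed.

Lemma gauss_shift (z : R) (n : nat) : 0 < z ->
  gauss (z + 1) (S n) = gauss z (S n) * (1 + (z + 1) * / INR (S n)) / z.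
Proof.
intros Hz. unfold gauss.
assert (HN : 0 < INR (S n)) by (apply lt_0_INR; lia).
rewrite Rpower_plus, Rpower_1 by exact HN.
pose proof (rising_shift z (S n)) as H.
replace (prod_f_R0 (fun i : nat => z + 1 + INR i) (S n))
  with (prod_f_R0 (fun i : nat => z + INR i) (S n) * (z + 1 + INR (S n)) / z)
  by (rewrite <- H; field; lra).
pose proof (INR_fact_lt_0 (S n)).
pose proof (exp_pos (z * ln (INR (S n)))).
unfold Rpower. field. repeat split; lra.
Qed.

Lemma is_lim_seq_inv_INR_S : is_lim_seq (fun n => / INR (S n)) 0.
Proof.
apply (is_lim_seq_incr_1 (fun n => / INR n)).
replace (Finite 0) with (Rbar_inv p_infty) by reflexivity.
apply is_lim_seq_inv; [apply is_lim_seq_INR | discriminate].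
Qed.

(** The functional equation [Gamma(z + 1) = z Gamma(z)], read on the Gauss products. *)
Lemma gauss_lim_shift (z l : R) : 0 < z ->
  is_lim_seq (gauss z) l -> is_lim_seq (gauss (z + 1)) (l / z).
Proof.
intros Hz Hl. apply is_lim_seq_incr_1.
apply is_lim_seq_ext with (fun n => gauss z (S n) * (1 + (z + 1) * / INR (S n)) * / z).
{ intros n. symmetry. now apply gauss_shift. }
replace (Finite (l / z)) with (Rbar_mult (l * (1 + (z + 1) * 0)) (/ z))
  by (simpl; f_equal; unfold Rdiv; ring).
apply is_lim_seq_scal_r.
apply is_lim_seq_mult'; [now apply is_lim_seq_incr_1 in Hl|].
apply is_lim_seq_plus'; [apply is_lim_seq_const|].
apply is_lim_seq_mult'; [apply is_lim_seq_const|].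
exact is_lim_seq_inv_INR_S.
Qed.

Lemma gauss_lim_pos (z : R) : 0 < z ->
  exists l, 0 < l /\ is_lim_seq (gauss z) l.
Proof.
intros Hz.
(* Unit shifts bring every positive argument down to [(0, 1]], where monotonicity is available. *)
assert (H : forall n z, 0 < z <= INR (S n) -> exists l, 0 < l /\ is_lim_seq (gauss z) l).
{ clear z Hz. induction n as [|n IH]; intros z Hz.
  - now apply gauss_lim_unit.
  - destruct (Rle_lt_dec z 1) as [H1|H1]; [apply gauss_lim_unit; lra|].
    destruct (IH (z - 1)) as [l [Hl0 Hl]].
    { rewrite (S_INR (S n)) in Hz. lra. }
    exists (l / (z - 1)). split; [apply Rdiv_lt_0_compat; lra|].
    replace z with (z - 1 + 1) at 1 by ring.
    apply gauss_lim_shift; [lra | exact Hl]. }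
destruct (nfloor_ex z) as [n Hn]; [lra|].
apply (H n). rewrite S_INR. lra.
Qed.

Lemma rGamma_lim (z l : R) : is_lim_seq (gauss z) l -> rGamma z = l.
Proof.
intros H. unfold rGamma. fold (gauss z). now rewrite (is_lim_seq_unique _ _ H).
Qed.

Lemma rGamma_pos (z : R) : 0 < z -> 0 < rGamma z.
Proof.
intros Hz. destruct (gauss_lim_pos z Hz) as [l [Hl0 Hl]].
now rewrite (rGamma_lim z l Hl).
Qed.

Lemma rGamma_0 : rGamma 0 = 0.
Proof.
apply rGamma_lim.
apply is_lim_seq_ext with (fun _ => 0); [|apply is_lim_seq_const].
intros n. unfold gauss.
replace (prod_f_R0 (fun i : nat => 0 + INR i) n) with 0; [unfold Rdiv; ring|].
induction n as [|n IH]; [simpl; ring|].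
simpl prod_f_R0. rewrite <- IH. ring.
Qed.

(** The pole of Gamma at 0 makes [z = 0] admissible; the lower bound at order 0, where [I_(-1)]
    occurs, relies on this case. *)
Lemma rGamma_rec (z : R) : 0 <= z -> rGamma z = z * rGamma (z + 1).
Proof.
intros [Hz | <-].
- destruct (gauss_lim_pos z Hz) as [l [_ Hl]].
  rewrite (rGamma_lim z l Hl), (rGamma_lim (z + 1) (l / z)).
  + field; lra.
  + now apply gauss_lim_shift.
- rewrite rGamma_0. ring.
Qed.

(** * The entire series underlying [I_nu]: derivative, positivity, recurrence *)

Definition bessel_coeff (z : R) (k : nat) : R := rGamma (z + INR k) / INR (fact k).

(* [I_nu(x) = (x/2)^nu * bessel_series (nu + 1) (x^2/4)]. *)
Definition bessel_series (z t : R) : R := PSeries (bessel_coeff z) t.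

Lemma bessel_coeff_pos (z : R) (k : nat) : 0 < z -> 0 < bessel_coeff z k.
Proof.
intros Hz. apply Rdiv_lt_0_compat; [|apply INR_fact_lt_0].
apply rGamma_pos. pose proof (pos_INR k). lra.
Qed.

Lemma bessel_coeff_derive (z : R) (k : nat) :
  PS_derive (bessel_coeff z) k = bessel_coeff (z + 1) k.
Proof.
unfold PS_derive, bessel_coeff. rewrite fact_simpl, mult_INR, S_INR.
replace (z + (INR k + 1)) with (z + 1 + INR k) by ring.
pose proof (pos_INR k). pose proof (INR_fact_lt_0 k). field. lra.
Qed.

(** Consecutive coefficients have ratio [1 / ((z + n) (n + 1))], which tends to 0. *)
Lemma bessel_coeff_radius (z : R) : 0 < z -> CV_radius (bessel_coeff z) = p_infty.
Proof.
intros Hz. apply CV_radius_infinite_DAlembert.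
{ intros n. pose proof (bessel_coeff_pos z n Hz). lra. }
apply is_lim_seq_le_le with (fun _ => 0) (fun n => / z * / INR (S n)).
- intros n. split; [apply Rabs_pos|].
  pose proof (pos_INR n). pose proof (INR_fact_lt_0 n).
  unfold bessel_coeff.
  assert (Hr : 0 < rGamma (z + INR n + 1)) by (apply rGamma_pos; lra).
  rewrite (rGamma_rec (z + INR n)) by lra.
  rewrite fact_simpl, mult_INR, S_INR.
  replace (z + (INR n + 1)) with (z + INR n + 1) by ring.
  replace (_ / _ / _) with (/ (z + INR n) * / (INR n + 1))
    by (field; repeat split; lra).
  assert (Ha : 0 < / (z + INR n)) by (apply Rinv_0_lt_compat; lra).
  assert (Hb : 0 < / (INR n + 1)) by (apply Rinv_0_lt_compat; lra).
  rewrite Rabs_pos_eq by nra.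
  apply Rmult_le_compat_r; [lra|]. apply Rinv_le_contravar; lra.
- apply is_lim_seq_const.
- replace (Finite 0) with (Finite (/ z * 0)) by (f_equal; ring).
  apply is_lim_seq_mult'; [apply is_lim_seq_const|].
  exact is_lim_seq_inv_INR_S.
Qed.

Lemma bessel_series_ex (z t : R) : 0 < z -> ex_pseries (bessel_coeff z) t.
Proof.
intros Hz. apply CV_radius_inside. now rewrite bessel_coeff_radius.
Qed.

Lemma bessel_series_derive (z t : R) : 0 < z ->
  is_derive (bessel_series z) t (bessel_series (z + 1) t).
Proof.
intros Hz. unfold bessel_series.
rewrite <- (PSeries_ext _ _ t (bessel_coeff_derive z)).
apply is_derive_PSeries. now rewrite bessel_coeff_radius.
Qed.

Lemma bessel_series_pos (z t : R) : 0 < z -> 0 <= t -> 0 < bessel_series z t.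
Proof.
intros Hz Ht.
apply Rlt_le_trans with (bessel_coeff z 0); [now apply bessel_coeff_pos|].
pose proof (PSeries_correct _ _ (bessel_series_ex z t Hz)) as H.
apply is_pseries_R in H.
change (is_lim_seq (sum_n (fun n => bessel_coeff z n * t ^ n)) (bessel_series z t)) in H.
assert (Hle : Rbar_le (bessel_coeff z 0) (bessel_series z t)); [|exact Hle].
apply (is_lim_seq_le (fun _ => bessel_coeff z 0) _ _ _) with (3 := H);
  [|apply is_lim_seq_const].
induction n as [|n IH].
- rewrite sum_O. simpl. lra.
- rewrite sum_Sn. change plus with Rplus.
  pose proof (bessel_coeff_pos z (S n) Hz). pose proof (pow_le t (S n) Ht). nra.
Qed.

(** Coefficientwise this is [rGamma_rec] with the factor [z + k] split: the [k] cancels into the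
    factorial and shifts the index. With [bessel_series_derive] it is the differential equation
    [p = nu q + t q']; at [t = x^2/4] it is the three-term recurrence of the Bessel functions. *)
Lemma bessel_series_rec (z t : R) : 0 <= z ->
  bessel_series z t = z * bessel_series (z + 1) t + t * bessel_series (z + 1 + 1) t.
Proof.
intros Hz. unfold bessel_series.
rewrite <- PSeries_scal, <- PSeries_incr_1, <- PSeries_plus.
- apply PSeries_ext. intros n.
  unfold PS_plus, PS_scal, PS_incr_1, bessel_coeff.
  change plus with Rplus. change scal with Rmult.
  pose proof (pos_INR n).
  rewrite (rGamma_rec (z + INR n)) by lra.
  replace (z + 1 + INR n) with (z + INR n + 1) by ring.
  destruct n as [|n].
  + change zero with 0. simpl. field.
  + rewrite fact_simpl, mult_INR, S_INR.
    replace (z + 1 + 1 + INR n) with (z + (INR n + 1) + 1) by ring.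
    pose proof (pos_INR n). pose proof (INR_fact_lt_0 n). field. lra.
- apply ex_pseries_scal; [apply Rmult_comm|]. apply bessel_series_ex. lra.
- apply ex_pseries_incr_1, bessel_series_ex. lra.
Qed.

(** * Positivity of the quadratic form [E] in [p] and [q] *)

Definition bessel_gap (nu t : R) : R :=
  bessel_series nu t ^ 2 - t * bessel_series (nu + 1) t ^ 2
  - (nu - 1 / 2) * (bessel_series nu t * bessel_series (nu + 1) t).

Lemma bessel_gap_derive (nu t : R) : 0 < nu ->
  is_derive (bessel_gap nu) t
    (2 * bessel_series nu t * bessel_series (nu + 1) t - bessel_series (nu + 1) t ^ 2
     - 2 * t * bessel_series (nu + 1) t * bessel_series (nu + 1 + 1) t
     - (nu - 1 / 2) * (bessel_series (nu + 1) t ^ 2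
                       + bessel_series nu t * bessel_series (nu + 1 + 1) t)).
Proof.
intros Hnu.
assert (Hp := bessel_series_derive nu t Hnu).
assert (Hq : is_derive (bessel_series (nu + 1)) t (bessel_series (nu + 1 + 1) t))
  by (apply bessel_series_derive; lra).
unfold bessel_gap. auto_derive.
- repeat split; eexists; eassumption.
- rewrite (is_derive_unique (fun x : R => bessel_series nu x) _ _ Hp).
  rewrite (is_derive_unique (fun x : R => bessel_series (nu + 1) x) _ _ Hq). ring.
Qed.

(** With [m = nu - 1/2], the differential equation gives [t E' + m E = m p q / 2], for which [t^m]
    is the integrating factor. *)
Lemma bessel_gap_weighted_derive (nu t : R) : 0 < nu -> 0 < t ->
  is_derive (fun s => exp ((nu - 1 / 2) * ln s) * bessel_gap nu s) t
    (exp ((nu - 1 / 2) * ln t) *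
     ((nu - 1 / 2) * (bessel_series nu t * bessel_series (nu + 1) t)) / (2 * t)).
Proof.
intros Hnu Ht.
pose proof (bessel_gap_derive nu t Hnu) as Hg.
auto_derive.
- repeat split; [exact Ht | eexists; exact Hg].
- rewrite (is_derive_unique (fun x : R => bessel_gap nu x) _ _ Hg).
  unfold bessel_gap.
  replace (bessel_series nu t)
    with (nu * bessel_series (nu + 1) t + t * bessel_series (nu + 1 + 1) t)
    by (symmetry; apply bessel_series_rec; lra).
  field. lra.
Qed.

Lemma bessel_gap_pos (nu t : R) : 1 / 2 <= nu -> 0 < t -> 0 < bessel_gap nu t.
Proof.
intros Hnu Ht.
assert (H0 : 0 < bessel_gap nu 0).
(* At [t = 0] the recurrence reduces to [p = nu q]. *)
{ unfold bessel_gap. rewrite (bessel_series_rec nu 0) by lra.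
  assert (0 < bessel_series (nu + 1) 0) by (apply bessel_series_pos; lra).
  set (q := bessel_series (nu + 1) 0) in *.
  replace (_ - _) with (nu / 2 * q ^ 2) by field. nra. }
(* The weight involves [ln s], so the mean value theorem cannot start at 0; continuity supplies the
   starting point [eps / 2]. *)
assert (Hnear : locally 0 (fun s => 0 < bessel_gap nu s)).
{ apply (ex_derive_continuous (bessel_gap nu) 0).
  - eexists. apply bessel_gap_derive. lra.
  - apply (open_gt 0). exact H0. }
destruct Hnear as [eps Heps].
assert (Hball : forall s, 0 < s < eps -> 0 < bessel_gap nu s).
{ intros s Hs. apply Heps. change (Rabs (s - 0) < eps).
  rewrite Rminus_0_r, Rabs_pos_eq; lra. }
destruct (Rlt_le_dec t eps) as [Hlt|Hge]; [apply Hball; lra|].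
pose proof (cond_pos eps) as He.
destruct (MVT_cor2 (fun s => exp ((nu - 1 / 2) * ln s) * bessel_gap nu s)
  (fun t => exp ((nu - 1 / 2) * ln t) *
     ((nu - 1 / 2) * (bessel_series nu t * bessel_series (nu + 1) t)) / (2 * t))
  (eps / 2) t) as [c [Hc Hct]]; [lra | |].
{ intros c Hc. apply is_derive_Reals, bessel_gap_weighted_derive; lra. }
assert (Hpos : 0 < exp ((nu - 1 / 2) * ln (eps / 2)) * bessel_gap nu (eps / 2)).
{ apply Rmult_lt_0_compat; [apply exp_pos | apply Hball; lra]. }
assert (Hinc : 0 <= exp ((nu - 1 / 2) * ln c) *
  ((nu - 1 / 2) * (bessel_series nu c * bessel_series (nu + 1) c)) / (2 * c)).
{ assert (0 < bessel_series nu c) by (apply bessel_series_pos; lra).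
  assert (0 < bessel_series (nu + 1) c) by (apply bessel_series_pos; lra).
  apply Rdiv_le_0_compat; [|lra].
  apply Rmult_le_pos; [left; apply exp_pos|].
  apply Rmult_le_pos; [lra|]. nra. }
pose proof (exp_pos ((nu - 1 / 2) * ln t)).
assert (0 < exp ((nu - 1 / 2) * ln t) * bessel_gap nu t) by nra.
nra.
Qed.

(** * The Bessel ratio and its continued-fraction step *)

Definition bessel_ratio (nu x : R) : R := BesselI nu x / BesselI (nu - 1) x.

Lemma bessel_ratio_series (nu x : R) : 0 < x ->
  bessel_ratio nu x =
  x / 2 * (bessel_series (nu + 1) (x ^ 2 / 4) / bessel_series nu (x ^ 2 / 4)).
Proof.
intros Hx. unfold bessel_ratio, BesselI, bessel_series.
rewrite (PSeries_ext _ (bessel_coeff (nu + 1)))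
  by (intros k; unfold bessel_coeff; do 2 f_equal; ring).
rewrite (PSeries_ext (fun k => rGamma (nu - 1 + INR k + 1) / _) (bessel_coeff nu))
  by (intros k; unfold bessel_coeff; do 2 f_equal; ring).
replace (Rpower (x / 2) nu) with (Rpower (x / 2) (nu - 1) * (x / 2)).
- pose proof (exp_pos ((nu - 1) * ln (x / 2))) as H.
  fold (Rpower (x / 2) (nu - 1)) in H.
  rewrite Rmult_assoc, Rdiv_mult_l_l by lra.
  unfold Rdiv. ring.
- rewrite <- (Rpower_1 (x / 2)) at 2 by lra.
  rewrite <- Rpower_plus. f_equal. ring.
Qed.

Lemma bessel_ratio_pos (nu x : R) : 0 < nu -> 0 < x -> 0 < bessel_ratio nu x.
Proof.
intros Hnu Hx. rewrite bessel_ratio_series by exact Hx.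
assert (0 <= x ^ 2 / 4) by nra.
apply Rmult_lt_0_compat; [lra|].
apply Rdiv_lt_0_compat; apply bessel_series_pos; lra.
Qed.

Lemma bessel_ratio_rec (nu x : R) : 0 <= nu -> 0 < x ->
  bessel_ratio nu x = x / (2 * nu + x * bessel_ratio (nu + 1) x).
Proof.
intros Hnu Hx. rewrite !bessel_ratio_series by exact Hx.
assert (Ht : 0 < x ^ 2 / 4) by nra.
rewrite (bessel_series_rec nu) by exact Hnu.
assert (Hq : 0 < bessel_series (nu + 1) (x ^ 2 / 4)) by (apply bessel_series_pos; lra).
assert (Hs : 0 < bessel_series (nu + 1 + 1) (x ^ 2 / 4)) by (apply bessel_series_pos; lra).
revert Hq Hs.
generalize (bessel_series (nu + 1) (x ^ 2 / 4)) (bessel_series (nu + 1 + 1) (x ^ 2 / 4)).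
intros q s Hq Hs.
assert (0 <= nu * q) by nra.
assert (0 < x ^ 2 * s) by nra.
field. repeat split; nra.
Qed.

(** * Elementary properties of the bounds *)

Lemma abs_lt_sqrt (l x : R) : 0 < x -> Rabs l < sqrt (l ^ 2 + x ^ 2).
Proof.
intros Hx. rewrite <- sqrt_Rsqr_abs. apply sqrt_lt_1_alt. unfold Rsqr. nra.
Qed.

Lemma denom_pos (l x : R) : 0 < x -> 0 < l + sqrt (l ^ 2 + x ^ 2).
Proof.
intros Hx. pose proof (abs_lt_sqrt l x Hx). pose proof (Rle_abs (- l)).
rewrite Rabs_Ropp in *. lra.
Qed.

Lemma denom_le (l1 l2 x : R) : 0 < x -> l1 <= l2 ->
  l1 + sqrt (l1 ^ 2 + x ^ 2) <= l2 + sqrt (l2 ^ 2 + x ^ 2).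
Proof.
intros Hx Hl.
pose proof (abs_lt_sqrt l2 x Hx) as Ha.
pose proof (Rabs_pos l2). pose proof (Rle_abs (- l2)). rewrite Rabs_Ropp in *.
assert (HS : sqrt (l2 ^ 2 + x ^ 2) ^ 2 = l2 ^ 2 + x ^ 2) by (apply pow2_sqrt; nra).
set (S := sqrt (l2 ^ 2 + x ^ 2)) in *.
(* After squaring, the difference of the two sides is [2 (l2 - l1) (S + l2)], and [S > |l2|]. *)
assert (sqrt (l1 ^ 2 + x ^ 2) <= l2 - l1 + S); [|lra].
rewrite <- (sqrt_pow2 (l2 - l1 + S)) by lra.
apply sqrt_le_1_alt. nra.
Qed.

(** Reduces both optimality claims to comparing [alpha] with 0 or 1. *)
Lemma b_bound_decr (a1 a2 nu x : R) : 0 < x -> a1 <= a2 ->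
  b_bound a2 nu x <= b_bound a1 nu x.
Proof.
intros Hx Ha. unfold b_bound. cbv zeta.
apply Rmult_le_compat_l; [lra|].
apply Rinv_le_contravar; [now apply denom_pos|].
apply denom_le; lra.
Qed.

Lemma b_bound_0 (nu x : R) :
  b_bound 0 nu x = x / (nu - 1 / 2 + sqrt ((nu - 1 / 2) ^ 2 + x ^ 2)).
Proof.
unfold b_bound. cbv zeta.
now replace (nu + / 2 * (0 - 1)) with (nu - 1 / 2) by field.
Qed.

Lemma b_bound_1 (nu x : R) : b_bound 1 nu x = x / (nu + sqrt (nu ^ 2 + x ^ 2)).
Proof.
unfold b_bound. cbv zeta.
now replace (nu + / 2 * (1 - 1)) with nu by field.
Qed.

(** * The upper and lower bounds *)

Lemma bessel_ratio_upper (nu x : R) : 1 / 2 <= nu -> 0 < x ->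
  x * bessel_ratio nu x < sqrt ((nu - 1 / 2) ^ 2 + x ^ 2) - (nu - 1 / 2).
Proof.
intros Hnu Hx.
assert (Hr := bessel_ratio_pos nu x ltac:(lra) Hx).
assert (Ht : 0 < x ^ 2 / 4) by nra.
assert (Hg := bessel_gap_pos nu _ Hnu Ht).
assert (Hp : 0 < bessel_series nu (x ^ 2 / 4)) by (apply bessel_series_pos; lra).
(* This is [E > 0] divided by [p^2]; completing the square then gives the bound. *)
assert (Hquad : bessel_ratio nu x ^ 2 * x + (2 * nu - 1) * bessel_ratio nu x < x).
{ rewrite bessel_ratio_series by exact Hx. unfold bessel_gap in Hg.
  revert Hg Hp.
  generalize (bessel_series nu (x ^ 2 / 4)) (bessel_series (nu + 1) (x ^ 2 / 4)).
  intros p q Hg Hp.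
  apply Rlt_0_minus.
  replace (_ - _) with (x * (p ^ 2 - x ^ 2 / 4 * q ^ 2 - (nu - 1 / 2) * (p * q)) / p ^ 2)
    by (field; lra).
  apply Rdiv_lt_0_compat; [|nra]. apply Rmult_lt_0_compat; lra. }
assert (nu - 1 / 2 + x * bessel_ratio nu x < sqrt ((nu - 1 / 2) ^ 2 + x ^ 2)); [|lra].
set (r := bessel_ratio nu x) in *.
rewrite <- (sqrt_pow2 (nu - 1 / 2 + x * r)) by nra.
apply sqrt_lt_1_alt. split; [apply pow2_ge_0|]. nra.
Qed.

(** With [m = nu - 1/2] and [S] the square root, [(S - m) (S + m) = x^2] turns [bessel_ratio_upper]
    into the stated quotient. *)
Lemma bessel_ratio_lt_b0 (nu x : R) : 1 / 2 <= nu -> 0 < x ->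
  bessel_ratio nu x < b_bound 0 nu x.
Proof.
intros Hnu Hx. rewrite b_bound_0.
pose proof (bessel_ratio_upper nu x Hnu Hx) as H.
pose proof (denom_pos (nu - 1 / 2) x Hx) as Hd.
assert (HS : sqrt ((nu - 1 / 2) ^ 2 + x ^ 2) ^ 2 = (nu - 1 / 2) ^ 2 + x ^ 2)
  by (apply pow2_sqrt; nra).
apply (Rlt_div_r _ _ _ Hd).
set (S := sqrt ((nu - 1 / 2) ^ 2 + x ^ 2)) in *.
apply Rmult_lt_reg_l with x; [exact Hx|]. nra.
Qed.

(* The upper bound of order [nu + 1], transported through the recurrence. Unlike [b_bound 1],
   it has the exact [1/x] term as [x] tends to infinity, as the optimality of [b_bound 0] needs. *)
Lemma bessel_ratio_lower (nu x : R) : 0 <= nu -> 0 < x ->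
  x / (nu - 1 / 2 + sqrt ((nu + 1 / 2) ^ 2 + x ^ 2)) < bessel_ratio nu x.
Proof.
intros Hnu Hx. rewrite bessel_ratio_rec by assumption.
pose proof (bessel_ratio_upper (nu + 1) x ltac:(lra) Hx) as H.
pose proof (bessel_ratio_pos (nu + 1) x ltac:(lra) Hx) as Hr.
replace (nu + 1 - 1 / 2) with (nu + 1 / 2) in H by field.
assert (0 < x * bessel_ratio (nu + 1) x) by now apply Rmult_lt_0_compat.
apply Rmult_lt_compat_l; [exact Hx|].
apply Rinv_lt_contravar; [apply Rmult_lt_0_compat|]; lra.
Qed.

Lemma b1_lt_bessel_ratio (nu x : R) : 0 <= nu -> 0 < x ->
  b_bound 1 nu x < bessel_ratio nu x.
Proof.
intros Hnu Hx. rewrite b_bound_1.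
eapply Rlt_trans; [|now apply bessel_ratio_lower].
pose proof (abs_lt_sqrt nu x Hx) as Ha. rewrite Rabs_pos_eq in Ha by exact Hnu.
assert (Hb : nu + 1 / 2 < sqrt ((nu + 1 / 2) ^ 2 + x ^ 2)).
{ rewrite <- (Rabs_pos_eq (nu + 1 / 2)) at 1 by lra. now apply abs_lt_sqrt. }
assert (HS : sqrt (nu ^ 2 + x ^ 2) ^ 2 = nu ^ 2 + x ^ 2) by (apply pow2_sqrt; nra).
(* The triangle inequality for [(nu, x) + (1/2, 0)], strict because [nu < S]. *)
assert (sqrt ((nu + 1 / 2) ^ 2 + x ^ 2) < 1 / 2 + sqrt (nu ^ 2 + x ^ 2)).
{ set (S := sqrt (nu ^ 2 + x ^ 2)) in *.
  rewrite <- (sqrt_pow2 (1 / 2 + S)) by lra.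
  apply sqrt_lt_1_alt. nra. }
apply Rmult_lt_compat_l; [exact Hx|].
apply Rinv_lt_contravar; [apply Rmult_lt_0_compat|]; lra.
Qed.

(** * Optimality of the two constants *)

Lemma b0_optimal (alpha : R) :
  (forall nu x, 1 / 2 <= nu -> 0 < x -> bessel_ratio nu x <= b_bound alpha nu x) ->
  alpha <= 0.
Proof.
intros H. apply Rnot_lt_le. intros Ha.
(* At [nu = 1/2], [lambda] equals [l]. The choice [x = 1 / l] makes [(l + x)^2 = l^2 + 2 + x^2]
   exceed [1 + x^2], against [H3] below. *)
set (l := alpha / 2). assert (Hl : 0 < l) by (unfold l; lra).
set (x := / l). assert (Hx : 0 < x) by now apply Rinv_0_lt_compat.
pose proof (H (1 / 2) x ltac:(lra) Hx) as H1.
pose proof (bessel_ratio_lower (1 / 2) x ltac:(lra) Hx) as H2.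
unfold b_bound in H1. cbv zeta in H1.
replace (1 / 2 + / 2 * (alpha - 1)) with l in H1 by (unfold l; field).
replace (1 / 2 - 1 / 2) with 0 in H2 by ring. rewrite Rplus_0_l in H2.
replace (1 / 2 + 1 / 2) with 1 in H2 by field.
pose proof (denom_pos l x Hx) as Hd.
assert (H3 : l + sqrt (l ^ 2 + x ^ 2) < sqrt (1 ^ 2 + x ^ 2)).
{ apply Rnot_le_lt. intros Hle.
  pose proof (Rinv_le_contravar _ _ (sqrt_lt_R0 (1 ^ 2 + x ^ 2) ltac:(nra)) Hle).
  unfold Rdiv in *. nra. }
assert (x <= sqrt (l ^ 2 + x ^ 2)).
{ rewrite <- (sqrt_pow2 x) at 1 by lra. apply sqrt_le_1_alt. nra. }
assert (l * x = 1) by (unfold x; field; lra).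
assert (sqrt (1 ^ 2 + x ^ 2) <= l + x); [|lra].
rewrite <- (sqrt_pow2 (l + x)) by lra. apply sqrt_le_1_alt. nra.
Qed.

Lemma b1_optimal (alpha : R) :
  (forall nu x, 0 <= nu -> 0 < x -> b_bound alpha nu x <= bessel_ratio nu x) ->
  1 <= alpha.
Proof.
intros H. apply Rnot_lt_le. intros Ha.
(* At this order [lambda = 0], so the bound is the constant 1. *)
set (nu := (1 - alpha) / 2). assert (Hnu : 0 < nu) by (unfold nu; lra).
pose proof (H nu nu ltac:(lra) Hnu) as H1.
unfold b_bound in H1. cbv zeta in H1.
replace (nu + / 2 * (alpha - 1)) with 0 in H1 by (unfold nu; field).
replace (0 ^ 2 + nu ^ 2) with (nu ^ 2) in H1 by ring.
rewrite sqrt_pow2, Rplus_0_l in H1 by lra.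
rewrite Rdiv_diag, bessel_ratio_rec in H1 by lra.
(* The ratio is now [nu / (2 nu + nu r)] with [r > 0], hence below 1. *)
pose proof (bessel_ratio_pos (nu + 1) nu ltac:(lra) Hnu) as Hr.
apply Rle_not_lt in H1. apply H1. apply Rlt_div_l; nra.
Qed.

Theorem theorem2 :
  (forall nu x : R, 0 < x -> 1 / 2 <= nu ->
     BesselI nu x / BesselI (nu - 1) x < b_bound 0 nu x /\
     b_bound 0 nu x = x / (nu - 1 / 2 + sqrt ((nu - 1 / 2) ^ 2 + x ^ 2))) /\
  (forall nu x : R, 0 < x -> 0 <= nu ->
     BesselI nu x / BesselI (nu - 1) x > b_bound 1 nu x /\
     b_bound 1 nu x = x / (nu + sqrt (nu ^ 2 + x ^ 2))) /\
  (forall alpha : R,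
     (forall nu x : R, 1 / 2 <= nu -> 0 < x ->
        BesselI nu x / BesselI (nu - 1) x <= b_bound alpha nu x) ->
     forall nu x : R, 1 / 2 <= nu -> 0 < x -> b_bound 0 nu x <= b_bound alpha nu x) /\
  (forall alpha : R,
     (forall nu x : R, 0 <= nu -> 0 < x ->
        b_bound alpha nu x <= BesselI nu x / BesselI (nu - 1) x) ->
     forall nu x : R, 0 <= nu -> 0 < x -> b_bound alpha nu x <= b_bound 1 nu x).
Proof.
repeat split.
- now apply bessel_ratio_lt_b0.
- apply b_bound_0.
- now apply b1_lt_bessel_ratio.
- apply b_bound_1.
- intros alpha H nu x _ Hx. apply b_bound_decr; [exact Hx | now apply b0_optimal].
- intros alpha H nu x _ Hx. apply b_bound_decr; [exact Hx | now apply b1_optimal].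
Qed.
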